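(* Let $X$ be a real topological-linear space, $(Y,\|\cdot\|)$ a real finite-dimensional normed space with dimension two or higher, $\Omega\subseteq X$ nonempty, $f:X\to Y$, and $\mathbb A:\Omega\to2^Y$ a cone-valued map. Assume that $K\subseteq Y$ is a nontrivial, closed, pointed, convex cone, $\bar x\in\mathrm{PEff}_{\mathbb A}(\Omega\mid f,K)$, and $A:=\mathbb A(\bar x)$ is a closed cone in $Y$ with $\{0\}\ne f[\Omega]-f(\bar x)\subseteq A$. Then there is a norm $\|\cdot\|'$ equivalent to $\|\cdot\|$ and a pair $(x^*,\alpha)\in K^{a\#}(\|\cdot\|')\cap(Y^*\times\mathbb P)$ such that, with $C:=C_{\|\cdot\|'}(x^*,\alpha)$, $\bar x\in\mathrm{Eff}(\Omega\mid f,C)$. Moreover, if $C\neq\ell(C)$ and $\varphi:Y\to\mathbb R$ is a sublinear functional with $\varphi(0)=0$ which is $-C$ representing, then: (i) for any $k\in C\setminus\ell(C)$, $\{(x,0)\mid x\in\Omega,\ f(x)=f(\bar x)\}$ is the set of solutions of $(P_\varphi^{a,k})$ for $a=f(\bar x)$; (ii) $\{x\in\Omega\mid f(x)=f(\bar x)\}=\operatorname{argmin}_{x\in\Omega}\varphi(f(x)-f(\bar x))$; (iii) if $\mathcal P\subseteq Y$, $\mathcal T\subseteq C\setminus\ell(C)$, $\mathcal R\subseteq\mathbb R$ satisfy $f[\mathrm{Eff}(\Omega\mid f,C)]\subseteq\mathcal P+\mathcal R\cdot\mathcal T$, then there are $a\in\mathcal P$, $k\in\mathcal T$, $s\in\mathcal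 R$ so that $\{(x,s)\mid x\in\Omega,\ f(x)=f(\bar x)\}$ is the set of solutions of $(P_\varphi^{a,k})$; (iv) if, in addition to the assumption in (iii), $C$ is closed, then there are $a\in\mathcal P$, $k\in\mathcal T$, $s\in\mathcal R$ so that $\varphi^G_{a-C,k}(f(\bar x))=s$ and $\{x\in\Omega\mid f(x)=f(\bar x)\}=\operatorname{argmin}_{x\in\Omega}\varphi^G_{a-C,k}(f(x))$.
   Context: $Y^*$ is the topological dual of $Y$, $\mathbb R_+=[0,\infty)$, $\mathbb P=(0,\infty)$. A set $K\subseteq Y$ is a cone if $0\in K=\mathbb R_+\cdot K$; it is nontrivial if $\{0\}\ne K\ne Y$; $\ell(K):=K\cap(-K)$; $K$ is pointed if $\ell(K)=\{0\}$. For a norm $\psi$: $K^{a\#}(\psi):=\{(x^*,\alpha)\in Y^*\times\mathbb R_+\mid\forall y\in K\setminus\{0\}:\ x^*(y)-\alpha\psi(y)>0\}$ and $C_\psi(x^*,\alpha):=\{y\in Y\mid x^*(y)\ge\alpha\psi(y)\}$. $\varphi$ is $-C$ representing if $-C=\{y\in Y\mid\varphi(y)\le0\}$. $\mathrm{Eff}(\Omega\mid f,C)$ is the set of $\bar x\in\Omega$ for which there is no $x\in\Omega$ with $f(x)\in f(\bar x)-(C\setminus\{0\})$; $\mathrm{PEff}_{\mathbb A}(\Omega\mid f,K)$ is the set of $\bar x\in\mathrm{Eff}(\Omega\mid f,K)$ with $\mathbb A(\bar x)\cap(-K)=\{0\}$. $f[D]$ is the image of $D$. $(P_\varphi^{a,k})$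 is the problem: minimize $\lambda$ subject to $\varphi(f(x)-a-\lambda k)\le0$, $(x,\lambda)\in\Omega\times\mathbb R$; a solution is a feasible pair with $\lambda$ minimal among all feasible pairs. $\varphi^G_{a-C,k}(y):=\inf\{t\in\mathbb R\mid y\in tk+(a-C)\}\in\mathbb R\cup\{\pm\infty\}$ ($\inf\emptyset=+\infty$). *)

(* Defs.v *)
From HB Require Import structures.
From mathcomp Require Import all_boot all_order all_algebra.
From mathcomp Require Import all_classical all_reals all_analysis.

Set Implicit Arguments.
Unset Strict Implicit.
Unset Printing Implicit Defensive.

Import Order.TTheory GRing.Theory Num.Theory.
Import numFieldNormedType.Exports.

Local Open Scope classical_set_scope.
Local Open Scope ring_scope.

(* The two parents share their [lmodType] structure, so the dimension of [V] is
   [\dim {:V}]. *)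
#[short(type="normedVectType")]
HB.structure Definition NormedVector (R : numFieldType) :=
  {V of NormedModule R V & Vector R V}.

Section SetArithmetic.
Context {R : numDomainType} {V : lmodType R}.
Implicit Types A B : set V.

Definition opp_set A : set V := [set - y | y in A].

Definition add_set A B : set V := [set a + b | a in A & b in B].

Definition scale_set (S : set R) A : set V := [set s *: y | s in S & y in A].

End SetArithmetic.

Section Cones.
Context {R : numDomainType} {V : lmodType R}.
Implicit Types K C : set V.

Definition cone K : Prop := K 0 /\ scale_set [set t | 0 <= t] K = K.

Definition nontrivial K : Prop := K <> [set 0] /\ K <> setT.

Definition lineality K : set V := K `&` opp_set K.

Definition pointed K : Prop := lineality K = [set 0].

Definition sublinear (phi : V -> R) : Prop :=
  (forall x y, phi (x + y) <= phi x + phi y) /\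
  (forall t x, 0 < t -> phi (t *: x) = t * phi x).

Definition opp_representing C (phi : V -> R) : Prop :=
  opp_set C = [set y | phi y <= 0].

End Cones.

Section Norms.
Context {R : numFieldType} {V : normedModType R}.

(* The axioms are those of the factory [Lmodule_isNormed]. *)
Definition is_norm (psi : V -> R) : Prop :=
  [/\ forall x y, psi (x + y) <= psi x + psi y,
      forall t x, psi (t *: x) = `|t| * psi x
    & forall x, psi x = 0 -> x = 0].

Definition equivalent_to_norm (psi : V -> R) : Prop :=
  exists c1 c2 : R, [/\ 0 < c1, 0 < c2 &
    forall y, c1 * `|y| <= psi y /\ psi y <= c2 * `|y|].

End Norms.

Section AugmentedDualCones.
Context {R : realType} {Y : normedModType R}.
Implicit Types (psi : Y -> R) (K : set Y).

Definition topological_dual : set {linear Y -> R^o} :=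
  [set x | continuous (x : Y -> R^o)].

Definition augmented_dual psi K : set ({linear Y -> R^o} * R) :=
  (topological_dual `*` [set a : R | 0 <= a]) `&`
  [set p : {linear Y -> R^o} * R | forall y, (K `\ 0) y -> 0 < p.1 y - p.2 * psi y].

Definition bishop_phelps psi (xs : {linear Y -> R^o}) (alpha : R) : set Y :=
  [set y | alpha * psi y <= xs y].

End AugmentedDualCones.

Section Efficiency.
Context {R : numDomainType} {X : Type} {Y : lmodType R}.
Variables (Omega : set X) (f : X -> Y).

Definition Eff (C : set Y) : set X :=
  [set xbar | Omega xbar /\
    ~ exists2 x, Omega x & [set f xbar - c | c in C `\ 0] (f x)].

Definition PEff (A : X -> set Y) (K : set Y) : set X :=
  Eff K `&` [set xbar | A xbar `&` opp_set K = [set 0]].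

End Efficiency.

Definition argmin {d : Order.disp_t} {T : porderType d} {X : Type}
    (Omega : set X) (g : X -> T) : set X :=
  [set x | Omega x /\ forall x', Omega x' -> (g x <= g x')%O].

Section Scalarization.
Context {R : realType} {X : Type} {Y : lmodType R}.
Variables (Omega : set X) (f : X -> Y).

Definition feasible (phi : Y -> R) (a k : Y) : set (X * R) :=
  [set p | Omega p.1 /\ phi (f p.1 - a - p.2 *: k) <= 0].

Definition solutions (phi : Y -> R) (a k : Y) : set (X * R) :=
  argmin (feasible phi a k) snd.

(* [+oo] when no translate [t *: k + (a - C)] contains [y]. *)
Definition gerstewitz (C : set Y) (a k : Y) (y : Y) : \bar R :=
  ereal_inf [set t%:E | t in [set t : R | [set t *: k + (a - c) | c in C] y]].

End Scalarization.

(* Main.v *)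
(* Since K is closed and pointed, some linear functional x satisfies
   |k| <= x k for all k in K: the Euclidean projection separates each -k from
   K, and finitely many of the resulting functionals suffice by compactness.
   Let d be the distance to K and
     psi y = max (|y|, x y + d y, - x y + d (- y)).
   Then psi = x on K, while x y >= alpha psi y gives
   alpha d y <= (1 - alpha) x y, so the Bishop-Phelps cones of psi and x shrink
   to K as alpha tends to 1 from below. As d is bounded below by a multiple of
   the norm on the closed cone - A, which meets K only at 0, for alpha close to
   1 the cone C also meets - A only at 0, so xbar is efficient for C.

   The scalarization results only use that C is a convex cone: if
   f x - f xbar - t k lies in - C with t <= 0, then so does f x - f xbar, hence
   f x = f xbar; and f xbar = a + s k reduces the problem at a to the one at
   f xbar by shifting t by s. *)
Require Import Defs.
From HB Require Import structures.
From mathcomp Require Import all_boot all_order all_algebra.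
From mathcomp Require Import finmap.
From mathcomp Require Import all_classical all_reals all_analysis.
From mathcomp Require Import ring lra.

Set Implicit Arguments.
Unset Strict Implicit.
Unset Printing Implicit Defensive.

Import Order.TTheory GRing.Theory Num.Theory.
Import numFieldNormedType.Exports.

Local Open Scope classical_set_scope.
Local Open Scope ring_scope.

Import VectorInternalTheory.

(** * Compactness and continuity in normed spaces *)

(** The minimum is attained, hence positive; an empty [S] takes the constant 1. *)
Lemma compact_pos_lb {R : realType} {T : topologicalType} (g : T -> R)
    (S : set T) :
  compact S -> continuous g -> (forall x, S x -> 0 < g x) ->
  exists2 c, 0 < c & forall x, S x -> c <= g x.
Proof.
move=> cS cg g0; have [->|/set0P S0] := eqVneq S set0; first by exists 1.
have [x Sx min] := compact_EVT_min S0 cS (continuous_subspaceT cg).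
exists (g x); first by apply: g0; rewrite inE in Sx.
by move=> y Sy; apply: min; rewrite inE.
Qed.

Lemma linear_le_norm_continuous {R : realType} {V W : normedModType R}
    (g : {linear V -> W}) M : (forall x, `|g x| <= M * `|x|) -> continuous g.
Proof.
move=> gM; apply/linear_bounded_continuous/linear_boundedP.
near=> r => x; apply: le_trans (gM x) _.
by apply: ler_wpM2r => //; near: r; exact: nbhs_pinfty_ge.
Unshelve. all: end_near. Qed.

Lemma norm1_closed {R : realType} (V : normedModType R) :
  closed [set y : V | `|y| = 1].
Proof.
apply: (@preimage_closed _ _ (Num.Def.normr : V -> R) [set 1]).
  by move=> y _; exact: norm_continuous.
exact: closed_eq.
Qed.

Lemma norm_normalize {R : realType} (V : normedModType R) (y : V) :
  y != 0 -> `| `|y|^-1 *: y| = 1.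
Proof. by move=> y0; rewrite normrZ normfV normr_id mulVf// normr_eq0. Qed.

(** * Topology of a finite-dimensional normed space through coordinates *)

Section FiniteDimension.
Context {R : realType} {Y : normedVectType R}.

Lemma le_mx_norm n (u : 'rV[R]_n) i : `|u 0 i| <= `|u|.
Proof.
by rewrite [leRHS]/Num.Def.normr /= mx_normrE; exact: (le_bigmax _ _ (0, i)).
Qed.

Lemma r2v_continuous : continuous (r2v : 'rV[R]_(dim Y) -> Y).
Proof.
(* The bound comes from expanding [u] in the standard basis, each coordinate being at most [|u|]. *)
apply: (@linear_le_norm_continuous _ _ _ (r2v : {linear 'rV[R]_(dim Y) -> Y})
  (\sum_j `|(r2v ('e_j : 'rV[R]_(dim Y)) : Y)|)) => u /=.
rewrite {1}[u]row_sum_delta linear_sum mulr_suml.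
apply: le_trans (ler_norm_sum _ _ _) _; apply: ler_sum => j _.
by rewrite linearZ normrZ mulrC ler_wpM2l// le_mx_norm.
Qed.

Lemma rV_norm1_compact n : compact [set u : 'rV[R]_n | `|u| = 1].
Proof.
apply: bounded_closed_compact.
  by exists 1; split=> // M M1 u /= ->; exact: ltW.
exact: norm1_closed.
Qed.

(** As [r2v] is injective and continuous, [|r2v u|] has a positive lower bound on the compact unit
    sphere; homogeneity does the rest. *)
Lemma v2r_le : exists2 c : R, 0 < c & forall y : Y, c * `|v2r y| <= `|y|.
Proof.
have cg : continuous (fun u : 'rV[R]_(dim Y) => `|(r2v u : Y)|).
  move=> u; apply: continuous_comp; first exact: r2v_continuous.
  exact: norm_continuous.
have [|c c0 cS] := compact_pos_lb (@rV_norm1_compact (dim Y)) cg.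
  move=> u u1; rewrite normr_gt0; apply/eqP => u0.
  have : u = 0 by apply: (can_inj r2vK); rewrite u0 linear0.
  by move: u1 => /[swap] ->/eqP; rewrite normr0 eq_sym oner_eq0.
exists c => // y; have [->|y0] := eqVneq (v2r y) 0.
  by rewrite normr0 mulr0.
have := cS _ (norm_normalize y0).
rewrite linearZ /= v2rK normrZ normfV normr_id.
by rewrite mulrC ler_pdivlMr ?normr_gt0.
Qed.

Lemma v2r_continuous : continuous (v2r : Y -> 'rV[R]_(dim Y)).
Proof.
have [c c0 cle] := v2r_le.
apply: (@linear_le_norm_continuous _ _ _
  (v2r : {linear Y -> 'rV[R]_(dim Y)}) c^-1).
by move=> y; rewrite mulrC ler_pdivlMr// mulrC; exact: cle.
Qed.

(** Heine-Borel, transported: [S] is the continuous image under [r2v] of a closed bounded set of row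
    vectors. *)
Lemma closed_bounded_compact (S : set Y) M :
  closed S -> (forall y, S y -> `|y| <= M) -> compact S.
Proof.
move=> clS bS; have -> : S = r2v @` (r2v @^-1` S).
  apply/seteqP; split=> [y Sy|_ [u Su <-]//].
  by exists (v2r y); rewrite /= v2rK.
apply: continuous_compact; first exact/continuous_subspaceT/r2v_continuous.
apply: bounded_closed_compact; last first.
  by apply: preimage_closed => // u _; exact: r2v_continuous.
have [c c0 cle] := v2r_le; exists (c^-1 * M); split; first exact: num_real.
move=> N MN u /bS uM; apply: le_trans (ltW MN).
by rewrite mulrC ler_pdivlMr// mulrC (le_trans _ uM)// -{1}[u]r2vK.
Qed.

Lemma closed_norm1_compact (S : set Y) :
  closed S -> compact (S `&` [set y | `|y| = 1]).
Proof.
move=> clS; apply: (closed_bounded_compact (M := 1)); last by move=> y [_ ->].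
by apply: closedI => //; exact: norm1_closed.
Qed.

(** * A Euclidean inner product from coordinates, as the norm of [Y] need not come from one *)

Definition dot (u v : Y) : R := \sum_i v2r u 0 i * v2r v 0 i.

Lemma dotC u v : dot u v = dot v u.
Proof. by apply: eq_bigr => i _; rewrite mulrC. Qed.

Lemma dotDr z u v : dot z (u + v) = dot z u + dot z v.
Proof.
by rewrite -big_split; apply: eq_bigr => i _; rewrite linearD mxE mulrDr.
Qed.

Lemma dotZr z a u : dot z (a *: u) = a * dot z u.
Proof.
by rewrite mulr_sumr; apply: eq_bigr => i _; rewrite linearZ mxE mulrCA.
Qed.

Lemma dotDl z u v : dot (u + v) z = dot u z + dot v z.
Proof. by rewrite !(dotC _ z) dotDr. Qed.

Lemma dotZl z a u : dot (a *: u) z = a * dot u z.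
Proof. by rewrite !(dotC _ z) dotZr. Qed.

Lemma dot0r z : dot z 0 = 0.
Proof. by rewrite -(scale0r (0 : Y)) dotZr mul0r. Qed.

Lemma dot_gt0 u : u != 0 -> 0 < dot u u.
Proof.
move=> u0; have d0 i : true -> 0 <= v2r u 0 i * v2r u 0 i.
  by rewrite -expr2 sqr_ge0.
rewrite lt_neqAle sumr_ge0// andbT eq_sym psumr_neq0//.
have /rV0Pn[i ui] : v2r u != 0.
  by apply: contra u0 => /eqP ui; rewrite -[u]v2rK ui linear0.
apply/hasP; exists i; first by rewrite mem_index_enum.
by rewrite -expr2 lt_neqAle sqr_ge0 eq_sym expf_eq0 ui.
Qed.

Lemma dot_is_linear z : linear (dot z : Y -> R^o).
Proof. by move=> a u v; rewrite dotDr dotZr. Qed.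

HB.instance Definition _ z :=
  GRing.isLinear.Build R Y R^o *:%R (dot z) (dot_is_linear z).

Lemma dot_le z : exists2 M, 0 <= M & forall y, `|dot z y| <= M * `|y|.
Proof.
have [c c0 cle] := v2r_le; exists ((\sum_i `|v2r z 0 i|) / c).
  by rewrite divr_ge0 ?sumr_ge0// ltW.
move=> y; rewrite -mulrA mulr_suml; apply: le_trans (ler_norm_sum _ _ _) _.
apply: ler_sum => i _; rewrite normrM ler_wpM2l// (le_trans (le_mx_norm _ _))//.
by rewrite mulrC ler_pdivlMr// mulrC.
Qed.

Lemma dot_continuous z : continuous (dot z : Y -> R).
Proof.
have [M _ dM] := dot_le z.
exact: (@linear_le_norm_continuous _ _ R^o (dot z : {linear Y -> R^o}) M dM).
Qed.

Lemma dot_diag_continuous : continuous (fun y : Y => dot y y).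
Proof.
pose q (u : 'rV[R]_(dim Y)) : R^o := \sum_i u 0 i * u 0 i.
have cq : continuous q.
  apply: (continuous_big (@add_continuous R^o)) => i _ u.
  by apply: continuousM; exact: coord_continuous.
move=> y; apply: (@continuous_comp _ _ _ v2r q).
  exact: v2r_continuous.
exact: cq.
Qed.


Lemma dotB_sqr z t v :
  dot (z + t *: v) (z + t *: v) = dot z z + t * (2 * dot z v + t * dot v v).
Proof. by rewrite dotDl !dotDr !dotZl !dotZr (dotC v z); ring. Qed.

(** Compactness of the unit sphere again, now with homogeneity of degree 2. *)
Lemma dot_coercive : exists2 c : R, 0 < c & forall y, c * `|y| ^+ 2 <= dot y y.
Proof.
have [|c c0 cS] :=
  compact_pos_lb (closed_norm1_compact closedT) dot_diag_continuous.
  by move=> y [_ y1]; apply: dot_gt0; rewrite -normr_gt0 y1.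
exists c => // y; have [->|y0] := eqVneq y 0.
  by rewrite normr0 expr0n mulr0 dot0r.
have := cS _ (conj I (norm_normalize y0)).
rewrite dotZl dotZr mulrA -expr2 exprVn mulrC.
by rewrite ler_pdivlMr// exprn_gt0// normr_gt0.
Qed.

(** * Separation and dual functionals for a closed convex cone *)

Section Separation.
Variable K : set Y.
Hypotheses (closedK : closed K) (K0 : K 0)
  (KD : forall y z, K y -> K z -> K (y + z))
  (KZ : forall t y, 0 <= t -> K y -> K (t *: y)).

(* [z] is [p - y] for [p] the Euclidean projection of [y] onto [K]. *)
Lemma cone_separation y : ~ K y ->
  exists2 z, (forall k, K k -> 0 <= dot z k) & dot z y < 0.
Proof.
move=> Ky; have [c c0 cdot] := dot_coercive.
pose g k := dot (k - y) (k - y).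
have cg : continuous g.
  move=> k; apply: (@continuous_comp _ _ _ (fun k => k - y) (fun u => dot u u)).
    by apply: cvgB; [exact: cvg_id|exact: cvg_cst].
  exact: dot_diag_continuous.
(* This sublevel set contains 0 and is compact by coercivity; elsewhere on [K], [g] exceeds [g 0],
   so its minimizer is global on [K]. *)
pose S := K `&` [set k | g k <= g 0].
have clS : closed S.
  apply: closedI => //; apply: (@preimage_closed _ _ g [set r | r <= g 0]).
    by move=> u _; exact: cg.
  exact: closed_le.
have bS k : S k -> `|k| <= `|y| + (1 + g 0 / c).
  move=> [_ gk]; rewrite -{1}[k](subrK y) [leRHS]addrC.
  apply: le_trans (ler_normD _ _) _; rewrite lerD2r.
  have : `|k - y| ^+ 2 <= g 0 / c.
    by rewrite ler_pdivlMr// mulrC (le_trans (cdot _)).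
  (* The inequality [r <= 1 + r ^+ 2] replaces a square root. *)
  by have := normr_ge0 (k - y); nra.
have [|p /set_mem[Kp _] pmin] :=
  compact_EVT_min (A := S) _ (closed_bounded_compact clS bS)
    (continuous_subspaceT cg).
  by exists 0; split=> /=.
have {}pmin k : K k -> g p <= g k.
  move=> Kk; have [g0|g0] := leP (g k) (g 0); first by apply: pmin; rewrite inE.
  by apply: le_trans (ltW g0); apply: pmin; rewrite inE; split=> /=.
set z := p - y.
(* First-order optimality: [2 * dot z v] is the derivative of [g] at [p] along [v]. *)
have dir v : (forall t, 0 < t -> t <= 1 -> K (p + t *: v)) -> 0 <= dot z v.
  move=> Kv; have vv : 0 <= dot v v.
    by have [->|/dot_gt0/ltW//] := eqVneq v 0; rewrite dot0r.
  rewrite leNgt; apply/negP => zv.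
  have h0 : 0 < dot v v - dot z v + 1 by lra.
  (* This step lies in [(0, 1]] and satisfies [t * dot v v < - dot z v], so moving by [t *: v] would
     lower [g] below its minimum. *)
  pose t := - dot z v / (dot v v - dot z v + 1).
  have tE : t * (dot v v - dot z v + 1) = - dot z v.
    by rewrite /t divfK// gt_eqF.
  have t0 : 0 < t by rewrite divr_gt0// oppr_gt0.
  have t1 : t <= 1 by rewrite ler_pdivrMr// mul1r; lra.
  have := pmin _ (Kv t t0 t1).
  rewrite /g (_ : p + t *: v - y = z + t *: v); last by rewrite addrAC.
  rewrite dotB_sqr -/z lerDl pmulr_rge0//; nra.
exists z => [k Kk|].
  by apply: dir => t t0 _; apply: KD => //; apply: KZ => //; exact: ltW.
(* Shrinking [p] stays in [K], so [- p] is an admissible direction; then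
   [dot z y = dot z p - dot z z] is negative. *)
have zp : dot z p <= 0.
  rewrite -oppr_ge0 -mulN1r -dotZr; apply: dir => t t0 t1.
  have -> : p + t *: (-1 *: p) = (1 - t) *: p.
    by rewrite scaleN1r scalerN scalerBl scale1r.
  by apply: KZ; rewrite ?subr_ge0.
have z0 : z != 0 by rewrite subr_eq0; apply/eqP => py; apply: Ky; rewrite -py.
have -> : y = p + -1 *: z by rewrite scaleN1r subKr.
by rewrite dotDr dotZr; have := dot_gt0 z0; lra.
Qed.

(** Pointedness keeps [- s] out of [K] for each unit [s] of [K], so separation gives a functional
    nonnegative on [K] and positive at [s]. The sum over a finite subcover is positive on all unit
    vectors of [K]; dividing by a lower bound gives the estimate. *)
Lemma pointed_cone_dual : (forall y, K y -> K (- y) -> y = 0) ->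
  exists z, forall k, K k -> `|k| <= dot z k.
Proof.
move=> ptK; pose S := K `&` [set k | `|k| = 1].
have cS : compact S by exact: closed_norm1_compact.
have /choice[F FP] (s : Y) : exists z,
    S s -> (forall k, K k -> 0 <= dot z k) /\ 0 < dot z s.
  have [[Ks s1]|nS] := pselect (S s); last by exists 0.
  have [Ns|z z0 zs] := @cone_separation (- s).
    by move: s1; rewrite /= (ptK s)// normr0 => /eqP; rewrite eq_sym oner_eq0.
  exists z => _; split=> //.
  by move: zs; rewrite -scaleN1r dotZr mulN1r oppr_lt0.
(* [compact_cover] is an equality of predicates; transporting [cS] along it extracts a finite
   subcover from the open half-spaces [0 < dot (F s) k]. *)
have [] := (eq_ind _ (fun P => P S) cS _ (@compact_cover Y)) Y S
  (fun s => [set k | 0 < dot (F s) k]).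
- move=> s Ss; apply: (@open_comp _ _ (dot (F s)) [set r | 0 < r]).
    by move=> k _; exact: dot_continuous.
  exact: open_gt.
- by move=> s Ss; exists s => //; exact: (FP s Ss).2.
move=> D DS SD; pose z := \sum_(s <- D) F s.
have zE k : dot z k = \sum_(s <- D) dot (F s) k.
  rewrite /z; elim: (enum_fset D) => [|s r IH].
    by rewrite !big_nil dotC dot0r.
  by rewrite !big_cons dotDl IH.
have [|c c0 cS'] := compact_pos_lb cS (@dot_continuous z).
  move=> k Sk; have [s sD sk] := SD k Sk.
  have Fge s' : s' \in D -> 0 <= dot (F s') k.
    by move=> /DS; rewrite inE => /FP[Fs _]; apply: Fs; case: Sk.
  rewrite zE (bigD1_seq s) ?fset_uniq//= ltr_pwDl//.
  by rewrite big_seq_cond sumr_ge0// => s' /andP[/Fge].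
exists (c^-1 *: z) => k Kk; have [->|k0] := eqVneq k 0.
  by rewrite normr0 dot0r.
have Kn : K (`|k|^-1 *: k) by apply: KZ; rewrite ?invr_ge0.
have := cS' _ (conj Kn (norm_normalize k0)); rewrite dotZr dotZl.
rewrite mulrC ler_pdivlMr ?normr_gt0// => h.
by rewrite mulrC ler_pdivlMr// mulrC.
Qed.

(** * Distance to the cone, a sublinear function *)

Definition dist (y : Y) : R := inf [set `|y - k| | k in K].

Lemma dist_lb y : lbound [set `|y - k| | k in K] 0.
Proof. by move=> _ [k _ <-]. Qed.

Lemma dist_ge0 y : 0 <= dist y.
Proof. by apply: lb_le_inf (@dist_lb y); exists `|y - 0|, 0. Qed.

Lemma dist_le y k : K k -> dist y <= `|y - k|.
Proof. by move=> Kk; apply: ge_inf; [exists 0; exact: dist_lb|exists k]. Qed.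

Lemma dist_adherent y e : 0 < e -> exists2 k, K k & `|y - k| < dist y + e.
Proof.
move=> e0; have [|_ [k Kk <-] ke] :=
  @inf_adherent _ [set `|y - k| | k in K] _ e0.
  by split; [exists `|y - 0|, 0|exists 0; exact: dist_lb].
by exists k.
Qed.

Lemma dist_le_norm y : dist y <= `|y|.
Proof. by have := dist_le y K0; rewrite subr0. Qed.

Lemma dist_in k : K k -> dist k = 0.
Proof.
move=> /(dist_le k); rewrite subrr normr0 => k0.
by apply/le_anti; rewrite k0 dist_ge0.
Qed.

Lemma distD y z : dist (y + z) <= dist y + dist z.
Proof.
apply/ler_addgt0Pr => e e0; have e2 : 0 < e / 2 by rewrite divr_gt0.
have [k Kk yk] := dist_adherent y e2; have [l Kl zl] := dist_adherent z e2.
apply: le_trans (dist_le _ (KD Kk Kl)) _.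
by rewrite opprD addrACA; apply: le_trans (ler_normD _ _) _; lra.
Qed.

Lemma distZ t y : 0 <= t -> dist (t *: y) = t * dist y.
Proof.
rewrite le_eqVlt => /predU1P[<-|]; first by rewrite scale0r mul0r dist_in.
(* The reverse inequality is this one applied to [t^-1] and [t *: y]. *)
have le s u : 0 < s -> dist (s *: u) <= s * dist u.
  move=> s0; rewrite -ler_pdivrMl//; apply: lb_le_inf.
    by exists `|u - 0|, 0.
  move=> _ [k Kk <-].
  rewrite ler_pdivrMl// -[s in leRHS](gtr0_norm s0) -normrZ scalerBr.
  by apply: dist_le; apply: KZ => //; exact: ltW.
move=> t0; apply/le_anti; rewrite le//= -ler_pdivlMl//.
have := @le t^-1 (t *: y); rewrite scalerA mulVf ?gt_eqF// scale1r invr_gt0.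
exact.
Qed.

(** Subadditivity and [dist_le_norm] make [dist] 1-Lipschitz. *)
Lemma dist_continuous : continuous dist.
Proof.
move=> y; apply/cvgrPdist_le => e e0; near=> z.
have yz : `|y - z| <= e by near: z; apply: cvgr_dist_le => //; exact: cvg_id.
have h1 := distD z (y - z); have h2 := distD y (z - y).
rewrite !subrKC in h1 h2; have h3 := dist_le_norm (y - z).
have h4 := dist_le_norm (z - y); rewrite distrC in h4.
by rewrite ler_norml; apply/andP; split; lra.
Unshelve. all: end_near. Qed.

Lemma dist_eq0 y : dist y = 0 -> K y.
Proof.
move=> y0; apply: closedK => B /nbhs_ballP[e /= e0 Be].
have [k Kk yk] := dist_adherent y e0; exists k; split=> //.
by apply: Be; rewrite -ball_normE /=; rewrite y0 add0r in yk.
Qed.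

(** Supplies the norm and the functional of the theorem. The last clause, that [A] meets the
    opposite of the Bishop-Phelps cone only at 0, yields efficiency. *)
Lemma bishop_phelps_separation (A : set Y) : closed A ->
    (forall t y, 0 <= t -> A y -> A (t *: y)) ->
    (forall y, K y -> K (- y) -> y = 0) ->
    (forall y, A y -> K (- y) -> y = 0) ->
  exists psi : Y -> R, [/\ is_norm psi, equivalent_to_norm psi &
  exists (xs : {linear Y -> R^o}) (alpha : R),
    [/\ topological_dual xs, 0 < alpha,
        forall k, K k -> k <> 0 -> 0 < xs k - alpha * psi k &
        forall y, A y -> bishop_phelps psi xs alpha (- y) -> y = 0]].
Proof.
move=> clA AZ ptK AK; have [z zK] := pointed_cone_dual ptK.
pose x : {linear Y -> R^o} := dot z; have [M M0 xM] := dot_le z.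
(* Replacing [y] by [- y] exchanges the last two terms, which makes [psi] even; the term [|y|] makes
   it definite. *)
pose psi y := Num.max `|y| (Num.max (x y + dist y) (dist (- y) - x y)).
have psiN y : psi (- y) = psi y.
  rewrite /psi normrN opprK linearN opprK; congr (Num.max _ _).
  by rewrite maxC; congr (Num.max _ _); rewrite addrC.
have psiZ t y : 0 <= t -> psi (t *: y) = t * psi y.
  move=> t0; rewrite /psi normrZ ger0_norm// -scalerN !distZ// linearZ /=.
  by rewrite !maxr_pMr// mulrDr mulrBr.
have psi_ge y : `|y| <= psi y by rewrite le_max lexx.
have psi_dist y : x y + dist y <= psi y by rewrite !le_max lexx orbT.
exists psi; split.
- split=> [y u|t y|y y0].
  + rewrite /psi !ge_max linearD opprD /= -!/(psi _); apply/and3P; split.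
    * by apply: le_trans (ler_normD _ _) _; rewrite lerD.
    * by have := distD y u; have := psi_dist y; have := psi_dist u; lra.
    * have := distD (- y) (- u); have := psi_dist (- y); have := psi_dist (- u).
      by rewrite !psiN !linearN /=; lra.
  + have [t0|/ltW t0] := leP 0 t; first by rewrite psiZ// ger0_norm.
    by rewrite ler0_norm// -psiZ ?oppr_ge0// scaleNr psiN.
  + by apply/eqP; rewrite -normr_le0 -y0.
- exists 1, (M + 1); split=> [//||y]; first by lra.
  rewrite mul1r; split=> //; have := xM y; rewrite ler_norml => /andP[xM1 xM2].
  have := dist_le_norm y; have := dist_le_norm (- y); rewrite normrN => d1 d2.
  have := normr_ge0 y => n0; have := mulr_ge0 M0 n0 => Mn0.
  by rewrite /psi !ge_max mulrDl mul1r; apply/and3P; split; rewrite /x /=; lra.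
(* On the unit sphere of [A], a zero distance would put [- y] in the closed [K] and force [y = 0];
   compactness turns positivity into [d]. *)
have [d d0 dA] : exists2 d, 0 < d & forall y, A y -> d * `|y| <= dist (- y).
  have [||d d0 dS] :=
    @compact_pos_lb _ _ (dist \o -%R) _ (closed_norm1_compact clA).
  - move=> y; apply: continuous_comp; first exact: opp_continuous.
    exact: dist_continuous.
  - move=> y [Ay y1]; rewrite lt_neqAle dist_ge0 andbT eq_sym; apply/eqP => y0.
    have {}y0 := AK y Ay (dist_eq0 y0).
    by move: y1; rewrite /= y0 normr0 => /eqP; rewrite eq_sym oner_eq0.
  exists d => // y Ay; have [->|y0] := eqVneq y 0.
    by rewrite normr0 mulr0 dist_ge0.
  have An : A (`|y|^-1 *: y) by apply: AZ; rewrite ?invr_ge0.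
  have := dS _ (conj An (norm_normalize y0)).
  by rewrite /= -scalerN distZ ?invr_ge0// mulrC ler_pdivlMr ?normr_gt0.
(* For [y] in [A] with [- y] in the cone, this [alpha] gives [(M + 1) * dist (- y) <= d * x (- y)].
   As [d * |y| <= dist (- y)] and [x (- y) <= M * |y|], it follows that
   [(M + 1) * |y| <= M * |y|]. *)
exists x, ((M + 1) / (M + 1 + d)).
have Md0 : 0 < M + 1 + d by lra.
split.
- exact: dot_continuous.
- by rewrite divr_gt0//; lra.
- move=> k Kk k0; have nk : 0 < `|k| by rewrite normr_gt0; exact/eqP.
  (* On [K] the distance vanishes and [|k| <= x k], so each term of [psi k] is at most [x k];
     strictness then comes from [alpha < 1]. *)
  have xk := zK k Kk; have psik : psi k <= dot z k.
    rewrite /psi !ge_max xk dist_in// addr0 lexx /=.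
    by have := dist_le_norm (- k); rewrite normrN /x /=; lra.
  rewrite subr_gt0 mulrAC ltr_pdivrMr// /x /=; nra.
- move=> y Ay; rewrite /bishop_phelps /= mulrAC ler_pdivrMr// => h.
  apply/eqP; rewrite -normr_le0 leNgt; apply/negP => ny.
  have h1 := dA y Ay; have h2 := psi_dist (- y); have := xM (- y).
  rewrite normrN ler_norml => /andP[_ h3].
  rewrite /x /= in h h2.
  have h4 : (M + 1) * (dot z (- y) + dist (- y)) <= dot z (- y) * (M + 1 + d).
    by apply: le_trans h; rewrite ler_wpM2l// addr_ge0.
  have h5 : (M + 1) * (d * `|y|) <= (M + 1) * dist (- y).
    by rewrite ler_wpM2l// addr_ge0.
  have h6 : d * dot z (- y) <= d * (M * `|y|) by rewrite ler_wpM2l// ltW.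
  have h7 : 0 < d * `|y| by rewrite mulr_gt0.
  by lra.
Qed.

End Separation.
End FiniteDimension.

(** * Convex cones and Bishop-Phelps cones *)

Lemma cone_scale {R : realType} {V : lmodType R} (K : set V) t y :
  cone K -> 0 <= t -> K y -> K (t *: y).
Proof. by move=> [_ KE] t0 Ky; rewrite -KE; exists t => //; exists y. Qed.

(** A sum is twice a midpoint. *)
Lemma convex_cone_add {R : realType} {V : lmodType R} (K : set V) y z :
  cone K -> convex_set K -> K y -> K z -> K (y + z).
Proof.
move=> coneK cvxK Ky Kz.
have half0 : 0 <= 2^-1 :> R by rewrite invr_ge0.
have half1 : 2^-1 <= 1 :> R by rewrite invf_le1// ler1n.
have := cvxK y z (Itv01 half0 half1) (mem_set Ky) (mem_set Kz).
rewrite inE => /(cone_scale coneK (ler0n R 2)).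
rewrite /conv /= scalerDr !scalerA.
have -> : 2 * 2^-1 = 1 :> R by rewrite mulfV.
have -> : 2 * (1 - 2^-1) = 1 :> R by lra.
by rewrite !scale1r.
Qed.

Section BishopPhelps.
Context {R : realType} {Y : normedModType R}.
Variables (psi : Y -> R) (xs : {linear Y -> R^o}) (alpha : R).
Hypotheses (normpsi : is_norm psi) (alpha0 : 0 < alpha).

Lemma bishop_phelps0 : bishop_phelps psi xs alpha 0.
Proof.
have [_ psiZ _] := normpsi.
by rewrite /bishop_phelps /= linear0 -(scale0r (0 : Y)) psiZ normr0 mul0r mulr0.
Qed.

Lemma bishop_phelpsD y z : bishop_phelps psi xs alpha y ->
  bishop_phelps psi xs alpha z -> bishop_phelps psi xs alpha (y + z).
Proof.
have [psiD _ _] := normpsi; rewrite /bishop_phelps /= linearD => hy hz.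
by apply: le_trans (lerD hy hz); rewrite -mulrDr ler_wpM2l// ltW.
Qed.

Lemma bishop_phelpsZ t y : 0 <= t ->
  bishop_phelps psi xs alpha y -> bishop_phelps psi xs alpha (t *: y).
Proof.
have [_ psiZ _] := normpsi; rewrite /bishop_phelps /= linearZ psiZ => t0 hy.
by rewrite ger0_norm// mulrCA ler_wpM2l.
Qed.

End BishopPhelps.

(** * Scalarization at an efficient point of a convex cone *)

Section Scalarization.
Context {R : realType} {X : Type} {Y : lmodType R}.
Variables (Omega : set X) (f : X -> Y) (C : set Y) (xbar : X).
Hypotheses (C0 : C 0) (CD : forall y z, C y -> C z -> C (y + z))
  (CZ : forall t y, 0 <= t -> C y -> C (t *: y)).
Hypothesis xbarC : Eff Omega f C xbar.

(** Otherwise [f xbar - f x] would be a nonzero element of [C] of the kind that efficiency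
    excludes. *)
Lemma Eff_opp x : Omega x -> C (f xbar - f x) -> f x = f xbar.
Proof.
move=> Ox Cx; apply: contrapT => fx; apply: xbarC.2; exists x => //.
exists (f xbar - f x); last by rewrite subKr.
by split=> //= /eqP; rewrite subr_eq0 => /eqP /esym.
Qed.

Lemma opp_representingP phi y :
  opp_representing C phi -> phi y <= 0 <-> C (- y).
Proof.
move=> repC; split=> [le0|Cy].
  have : opp_set C y by rewrite repC.
  by case=> c Cc <-; rewrite opprK.
have : [set y | phi y <= 0] y by rewrite -repC; exists (- y); rewrite // opprK.
by [].
Qed.

Lemma not_lineality_opp k : (C `\` lineality C) k -> ~ C (- k).
Proof.
by case=> Ck Lk CNk; apply: Lk; split=> //; exists (- k); rewrite // opprK.
Qed.

(** If [t < 0], then [- k] is a positive multiple of [t *: k], yet it lies outside [C] because [k]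
    is not in the lineality space. *)
Lemma ray_sub_cone k t : (C `\` lineality C) k -> C (t *: k) <-> 0 <= t.
Proof.
move=> Ck; split=> [Ctk|t0]; last by apply: CZ => //; case: Ck.
rewrite leNgt; apply/negP => t0; apply: (not_lineality_opp Ck).
have -> : - k = (- t^-1) *: (t *: k).
  by rewrite scalerA mulNr mulVf ?lt_eqF// scaleN1r.
by apply: CZ => //; rewrite oppr_ge0 invr_le0 ltW.
Qed.

(** As [t <= 0], [C] contains [- t *: k]; adding it leaves [f xbar - f x] in [C], and efficiency
    applies. *)
Lemma Eff_shift x k t : (C `\` lineality C) k -> Omega x ->
  C (f xbar - f x + t *: k) -> t <= 0 -> f x = f xbar.
Proof.
move=> [Ck _] Ox Cx t0; apply: Eff_opp => //.
rewrite -[_ - _](addrK (t *: k)) -scaleNr.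
by apply: CD => //; apply: CZ; rewrite // oppr_ge0.
Qed.

(** Covers (i), with [a = f xbar] and [s = 0], as well as (iii). *)
Lemma solutions_shift phi a k s : opp_representing C phi ->
    (C `\` lineality C) k -> f xbar = a + s *: k ->
  solutions Omega f phi a k =
  [set (x, s) | x in [set x | Omega x /\ f x = f xbar]].
Proof.
move=> repC Ck fxbar.
(* Substituting [f xbar = a + s *: k] eliminates [a]: only the shifted parameter [t - s] remains. *)
have feasE x t : feasible Omega f phi a k (x, t) <->
    Omega x /\ C (f xbar - f x + (t - s) *: k).
  rewrite /feasible /= (opp_representingP _ repC).
  suff -> : - (f x - a - t *: k) = f xbar - f x + (t - s) *: k by [].
  rewrite fxbar !opprB [RHS]addrAC -[a + _ + _]addrA -scalerDl subrKC.
  by rewrite addrCA addrA.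
have feas_ge x t : feasible Omega f phi a k (x, t) -> s <= t.
  move=> /feasE[Ox Cx]; rewrite leNgt; apply/negP => ts.
  have ts0 : t - s <= 0 by rewrite subr_le0 ltW.
  have fx := Eff_shift Ck Ox Cx ts0.
  move: Cx; rewrite fx subrr add0r => /(ray_sub_cone _ Ck).
  by rewrite subr_ge0 leNgt ts.
have feas_s x : Omega x -> f x = f xbar -> feasible Omega f phi a k (x, s).
  by move=> Ox fx; apply/feasE; rewrite fx !subrr scale0r addr0.
apply/seteqP; split=> [[x t] [Fx min]|_ [x [Ox fx] <-]].
  have ts : t = s.
    apply/le_anti; rewrite (feas_ge x)// andbT.
    by apply: (min (xbar, s)); apply: feas_s => //; case: xbarC.
  move: Fx; rewrite ts => /feasE[Ox Cx]; exists x => //; split=> //.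
  by apply: (Eff_shift Ck Ox Cx); rewrite subrr.
split; first exact: feas_s.
by case=> x' t; exact: feas_ge.
Qed.

(** A nonpositive value of [phi] at [f x - f xbar] already forces [f x = f xbar], so 0 is the least
    value and is taken only there. *)
Lemma argmin_representing phi : opp_representing C phi -> phi 0 = 0 ->
  [set x | Omega x /\ f x = f xbar] =
    argmin Omega (fun x => phi (f x - f xbar)).
Proof.
move=> repC phi0.
have eqx x : Omega x -> phi (f x - f xbar) <= 0 -> f x = f xbar.
  by move=> Ox /(opp_representingP _ repC); rewrite opprB; exact: Eff_opp.
apply/seteqP; split=> x [Ox min]; split=> //.
  move=> x' Ox'; rewrite min subrr phi0 leNgt; apply/negP => lt0.
  by move: (lt0); rewrite (eqx x') ?ltW// subrr phi0 ltxx.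
by apply: eqx => //; have := min xbar xbarC.1; rewrite subrr phi0.
Qed.

End Scalarization.

(** The shifted constraint of [solutions_shift] reappears as [E x], so [s] bounds the functional
    below on [Omega]. Closedness of [C] recovers [f x = f xbar] from the value [s], since attainment
    of the infimum is not known beforehand. *)
Lemma gerstewitz_argmin {R : realType} {X : Type} {Y : normedModType R}
    (Omega : set X) (f : X -> Y) (C : set Y) (xbar : X) a k s :
    (forall y z, C y -> C z -> C (y + z)) ->
    (forall t y, 0 <= t -> C y -> C (t *: y)) ->
    Eff Omega f C xbar -> closed C ->
    (C `\` lineality C) k -> f xbar = a + s *: k ->
  gerstewitz C a k (f xbar) = s%:E /\
  [set x | Omega x /\ f x = f xbar] =
    argmin Omega (fun x => gerstewitz C a k (f x)).
Proof.
move=> CD CZ xbarC clC Ck fxbar.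
have C0 : C 0 by rewrite -(scale0r k); apply: CZ => //; case: Ck.
pose E x := [set t : R | C (f xbar - f x + (t - s) *: k)].
have gE x : gerstewitz C a k (f x) = ereal_inf [set t%:E | t in E x].
  rewrite /gerstewitz; congr (ereal_inf (_ @` _)).
  have eqE t : f xbar - f x + (t - s) *: k = a + t *: k - f x.
    by rewrite fxbar addrAC -[a + _ + (t - _) *: _]addrA -scalerDl subrKC.
  apply/seteqP; split=> t; rewrite /E /= eqE.
    by case=> c Cc <-; rewrite addrA [_ *: k + _]addrC subKr.
  move=> Cx; eexists; first exact: Cx.
  by rewrite opprB addrA [_ *: k + a]addrC subrKC.
have geE x t : Omega x -> E x t -> s <= t.
  move=> Ox Et; rewrite leNgt; apply/negP => ts.
  have ts0 : t - s <= 0 by rewrite subr_le0 ltW.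
  have fx := Eff_shift CD CZ xbarC Ck Ox Et ts0.
  move: Et; rewrite /E /= fx subrr add0r => /(ray_sub_cone CZ _ Ck).
  by rewrite subr_ge0 leNgt ts.
have g_ge x : Omega x -> (s%:E <= gerstewitz C a k (f x))%E.
  move=> Ox; rewrite gE; apply: le_ereal_inf_tmp => _ [t Et <-].
  by rewrite lee_fin (geE x).
have g_s x : Omega x -> f x = f xbar -> gerstewitz C a k (f x) = s%:E.
  move=> Ox fx; apply/le_anti; rewrite g_ge// andbT gE.
  apply: ereal_inf_lbound; exists s => //.
  by rewrite /E /= fx !subrr scale0r addr0.
split; first by apply: g_s => //; case: xbarC.
apply/seteqP; split=> x [Ox]; rewrite /=.
  by move=> fx; split=> // x' Ox'; rewrite g_s// g_ge.
move=> min; split=> //.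
have {min} gx : gerstewitz C a k (f x) = s%:E.
  apply/le_anti; rewrite g_ge// andbT -(g_s xbar) //; last by case: xbarC.
  by apply: min; case: xbarC.
(* [f xbar - f x] is a limit of the points [f xbar - f x + (t - s) *: k] of [C] as [t] tends to
   [s]. *)
apply: (Eff_opp xbarC) => //; apply: clC => B.
move=> /nbhs_ballP[e /= e0 Be].
have k0 : 0 < `|k|.
  rewrite normr_gt0; apply/eqP => k0; apply: (not_lineality_opp Ck).
  by rewrite k0 oppr0.
(* The margin [e / |k|] keeps the norm of [(t - s) *: k] below [e]. *)
have : (ereal_inf [set t%:E | t in E x] < (s + e / `|k|)%:E)%E.
  by rewrite -gE gx lte_fin ltrDl divr_gt0.
move=> /ereal_inf_lt[_ [t Et <-]]; rewrite lte_fin => ts.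
eexists; split; first exact: Et.
apply: Be; rewrite -ball_normE /= opprD addrA subrr add0r normrN normrZ.
by rewrite -ltr_pdivlMr // ger0_norm ?subr_ge0 ?(geE x)// ltrBlDl.
Qed.

Theorem corollary35 (R : realType) (X : topologicalLmodType R)
    (Y : normedVectType R) (dimY : (2 <= \dim {:Y})%N)
    (Omega : set X) (Omega_neq0 : Omega !=set0) (f : X -> Y)
    (A : X -> set Y) (coneA : forall x, Omega x -> cone (A x))
    (K : set Y) (coneK : cone K) (ntK : nontrivial K) (closedK : closed K)
    (pointedK : pointed K) (convexK : convex_set K)
    (xbar : X) (xbarP : PEff Omega f A K xbar)
    (closedA : closed (A xbar))
    (fOmega_neq : [set 0] <> [set f x - f xbar | x in Omega])
    (fOmega_sub : [set f x - f xbar | x in Omega] `<=` A xbar) :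
  exists psi : Y -> R, [/\ is_norm psi, equivalent_to_norm psi &
  exists (xs : {linear Y -> R^o}) (alpha : R),
    (augmented_dual psi K `&` (topological_dual `*` [set a : R | 0 < a]))
      (xs, alpha) /\
    let C := bishop_phelps psi xs alpha in
    Eff Omega f C xbar /\
    (C <> lineality C ->
     forall phi : Y -> R,
       sublinear phi -> phi 0 = 0 -> opp_representing C phi ->
     [/\ (* (i) *)
         forall k, (C `\` lineality C) k ->
           solutions Omega f phi (f xbar) k =
           [set (x, 0) | x in [set x | Omega x /\ f x = f xbar]],
         (* (ii) *)
         [set x | Omega x /\ f x = f xbar] =
           argmin Omega (fun x => phi (f x - f xbar)),
         (* (iii) *)
         forall (P T : set Y) (S : set R),
           T `<=` C `\` lineality C ->
           f @` Eff Omega f C `<=` add_set P (scale_set S T) ->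
           exists a k s, [/\ P a, T k, S s &
             solutions Omega f phi a k =
             [set (x, s) | x in [set x | Omega x /\ f x = f xbar]]]
       & (* (iv) *)
         forall (P T : set Y) (S : set R),
           T `<=` C `\` lineality C ->
           f @` Eff Omega f C `<=` add_set P (scale_set S T) ->
           closed C ->
           exists a k s, [/\ P a, T k, S s,
             gerstewitz C a k (f xbar) = s%:E &
             [set x | Omega x /\ f x = f xbar] =
             argmin Omega (fun x => gerstewitz C a k (f x))]])].
Proof.
have [[Oxbar Exbar] AK0] := xbarP.
have ptK y : K y -> K (- y) -> y = 0.
  move=> Ky KNy; have : lineality K y.
    by split=> //; exists (- y); rewrite // opprK.
  by rewrite pointedK.
have AK y : A xbar y -> K (- y) -> y = 0.
  move=> Ay KNy; have : (A xbar `&` opp_set K) y.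
    by split=> //; exists (- y); rewrite // opprK.
  by rewrite AK0.
have [psi [normpsi eqpsi [xs [alpha [xs_dual alpha0 xsK AC]]]]] :=
  bishop_phelps_separation closedK (proj1 coneK)
    (fun y z => convex_cone_add coneK convexK)
    (fun t y => cone_scale coneK) closedA
    (fun t y => cone_scale (coneA xbar Oxbar)) ptK AK.
exists psi; split=> //; exists xs, alpha; split.
  split; split=> //=; first by split=> //; exact: ltW.
  by move=> y [Ky y0]; exact: xsK.
move=> C.
have xbarC : Eff Omega f C xbar.
  split=> // -[x Ox [c [Cc c0] fx]]; apply: c0 => /=.
  (* [c] is the opposite of a point of [A xbar], so [AC] forces it to be 0. *)
  have /AC : A xbar (f x - f xbar) by apply: fOmega_sub; exists x.
  rewrite opprB -fx subKr => /(_ Cc) /eqP.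
  by rewrite subr_eq0 -subr_eq0 addrC addKr oppr_eq0 => /eqP.
split=> // _ phi _ phi0 repC.
have C0 : C 0 := bishop_phelps0 xs alpha normpsi.
have CD := bishop_phelpsD (xs := xs) normpsi alpha0.
have CZ := bishop_phelpsZ (xs := xs) (alpha := alpha) normpsi.
(* Since [xbar] is efficient, its image is covered; decomposing it gives the witnesses of (iii) and
   (iv). *)
have decomp (P T : set Y) (S : set R) :
    f @` Eff Omega f C `<=` add_set P (scale_set S T) ->
    exists a k s, [/\ P a, T k, S s & f xbar = a + s *: k].
  move=> /(_ (f xbar)) []; first by exists xbar.
  by move=> a Pa [_ [s Ss [k Tk <-]] <-]; exists a, k, s.
split.
- move=> k Ck; apply: (solutions_shift C0 CD CZ xbarC repC Ck).
  by rewrite scale0r addr0.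
- exact: (argmin_representing xbarC repC phi0).
- move=> P T S TC /decomp[a [k [s [Pa Tk Ss fxbar]]]].
  exists a, k, s; split=> //.
  exact: (solutions_shift C0 CD CZ xbarC repC (TC k Tk)).
- move=> P T S TC /decomp[a [k [s [Pa Tk Ss fxbar]]]] clC; exists a, k, s.
  by have [gs argminE] := gerstewitz_argmin CD CZ xbarC clC (TC k Tk) fxbar.
Qed.
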